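(* Let $\phi>1$. If $G$ is a $(\phi,\alpha)$-expander on $n$ nodes for some $\alpha>\tfrac{1}{2+2\phi}$, then $G$ has diameter at most $O(\log_\phi n)$ (with an absolute implied constant).
   Context: Graphs are finite, simple, undirected and unweighted. For $S\subseteq V$ let $N(S)=\{v\in V:\exists s\in S,\ \{s,v\}\in E\}$ and $\partial S=N(S)\setminus S$. For $\phi\in(0,n)$ and $\alpha\in(0,\tfrac12]$, a graph $G=(V,E)$ with $n$ nodes is a $(\phi,\alpha)$-expander (small-set vertex expander) if $|\partial S|\ge \phi|S|$ for every $S\subseteq V$ with $0<|S|\le\alpha n$.
   Formalization: False as stated (n=2, φ=1.5, α=0.3, empty graph). The bound is proved if ⌊αn⌋/n > 1/(2+2φ), or if G is connected and αn ≥ 1; and, with the same constant, for fixed φ, α and all n ≥ N(φ,α) without extra assumption. *)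

(* Defs.v *)
From mathcomp Require Import all_boot all_order all_algebra.
From mathcomp Require Import all_classical all_reals all_analysis.

Set Implicit Arguments.
Unset Strict Implicit.
Unset Printing Implicit Defensive.

Import Order.TTheory GRing.Theory Num.Theory.

Local Open Scope ring_scope.

Record sgraph (T : finType) := SGraph {
  adj :> rel T;
  adj_sym : symmetric adj;
  adj_irrefl : irreflexive adj }.

Definition neighbors (T : finType) (G : sgraph T) (S : {set T}) : {set T} :=
  [set v | [exists s in S, G s v]]%SET.

Definition boundary (T : finType) (G : sgraph T) (S : {set T}) : {set T} :=
  (neighbors G S :\: S)%SET.

Definition expander (R : realType) (phi alpha : R) (T : finType)
    (G : sgraph T) : Prop :=
  [/\ 0 < phi < #|T|%:R, 0 < alpha <= 2^-1 &
      forall S : {set T}, (0 < #|S|)%N -> #|S|%:R <= alpha * #|T|%:R ->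
        phi * #|S|%:R <= #|boundary G S|%:R].

(* The infimum of the empty set is +oo, so vertices in different components
   are at distance +oo and a disconnected graph has diameter +oo. *)
Definition gdist (R : realType) (T : finType) (G : sgraph T) (u v : T) :
    \bar R :=
  ereal_inf [set (size p)%:R%:E | p in
               [set p : seq T | path G u p /\ last u p = v]]%classic.

Definition diameter (R : realType) (T : finType) (G : sgraph T) : \bar R :=
  ereal_sup [set gdist R G uv.1 uv.2 | uv in [set: T * T]]%classic.

Definition connected_graph (T : finType) (G : sgraph T) : Prop :=
  forall u v : T, connect G u v.

Definition logb (R : realType) (b x : R) : R := ln x / ln b.

(* Main.v *)
(* Balls grow by a factor at least [phi] per step until they have more than
   [k = floor (alpha n)] elements; one further step from a [k]-subset then gives
   at least [(1 + phi) k] elements, all within [r = O(log_phi n)] steps.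
   If [k / n > 1 / (2 + 2 phi)], this exceeds [n / 2], so any two balls of
   radius [r] meet and the graph is connected. If only [k >= 1], it still
   exceeds [n / 4], because [2 k >= k + 1 > alpha n]. In a connected graph,
   balls of radius [r] around points of a geodesic that are more than [2 r]
   apart are disjoint, so four of them do not fit and the diameter is below
   [3 (2 r + 1)]. *)

Require Import Defs.
From mathcomp Require Import all_boot all_order all_algebra.
From mathcomp Require Import all_classical all_reals all_analysis.
From mathcomp Require Import zify lra.

Set Implicit Arguments.
Unset Strict Implicit.
Unset Printing Implicit Defensive.

Import Order.TTheory GRing.Theory Num.Theory.

Local Open Scope ring_scope.

Section Balls.
Variables (T : finType) (G : sgraph T).
Implicit Types (S A : {set T}) (x y z : T) (t : nat) (p q : seq T).

Definition cl_neighbors S : {set T} := (S :|: neighbors G S)%SET.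

Definition ball_of t x : {set T} := iter t cl_neighbors [set x]%SET.

Lemma cl_neighborsS S A : S \subset A -> cl_neighbors S \subset cl_neighbors A.
Proof.
move=> sSA; rewrite finset.setUSS //; apply/fintype.subsetP => v.
rewrite !inE => /existsP[s /andP[sS Gsv]].
by apply/existsP; exists s; rewrite (fintype.subsetP sSA) ?Gsv.
Qed.

Lemma card_cl_neighbors S : #|cl_neighbors S| = (#|S| + #|boundary G S|)%N.
Proof.
have -> : cl_neighbors S = (S :|: boundary G S)%SET.
  by apply/setP => v; rewrite !inE; case: (v \in S).
rewrite cardsU (_ : (S :&: _)%SET = finset.set0) ?cards0 ?subn0 //.
by apply/setP => v; rewrite !inE; case: (v \in S).
Qed.

Lemma card_ball_ofS t x : (#|ball_of t x| <= #|ball_of t.+1 x|)%N.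
Proof. by rewrite /= card_cl_neighbors leq_addr. Qed.

Lemma card_ball_of_gt0 t x : (0 < #|ball_of t x|)%N.
Proof.
by elim: t => [|t IH]; [rewrite cards1 | exact: leq_trans (card_ball_ofS t x)].
Qed.

Lemma ball_of_path t x y : y \in ball_of t x ->
  exists p, [/\ path G x p, last x p = y & (size p <= t)%N].
Proof.
elim: t y => [|t IH] y /=; first by rewrite inE => /eqP->; exists [::].
rewrite inE => /orP[/IH[p [Gp py sp]]|].
  by exists p; rewrite (leq_trans sp).
rewrite inE => /existsP[z /andP[/IH[p [Gp pz sp]] Gzy]].
exists (rcons p y); rewrite rcons_path Gp pz Gzy last_rcons size_rcons.
by split.
Qed.

Lemma sgraph_rev_path x p : path G x p ->
  exists q, [/\ path G (last x p) q, last (last x p) q = x & size q = size p].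
Proof.
move=> Gp; exists (rev (belast x p)); split.
- rewrite rev_path; apply: sub_path Gp => a b /=.
  by rewrite adj_sym.
- by case: p Gp => //= a p _; rewrite rev_cons last_rcons.
- by rewrite size_rev size_belast.
Qed.

Lemma ball_of_meet_path t x y z : z \in ball_of t x -> z \in ball_of t y ->
  exists p, [/\ path G x p, last x p = y & (size p <= t + t)%N].
Proof.
move=> /ball_of_path[p [Gp pz sp]] /ball_of_path[q [Gq qz sq]].
have [q' [Gq' q'y sq']] := sgraph_rev_path Gq.
exists (p ++ q'); rewrite cat_path last_cat Gp pz -qz Gq' q'y size_cat sq'.
by split=> //; apply: leq_add.
Qed.

Lemma shortest_path x y : connect G x y ->
  exists p, [/\ path G x p, last x p = y &
    forall q, path G x q -> last x q = y -> (size p <= size q)%N].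
Proof.
move=> /connectP[p0 Gp0 yp0].
pose P n := `[< exists p, [/\ path G x p, last x p = y & size p = n] >].
have exP : exists n, P n by exists (size p0); apply/asboolP; exists p0.
case: (ex_minnP exP) => n /asboolP[p [Gp py <-]] min_n.
by exists p; split=> // q Gq qy; apply: min_n; apply/asboolP; exists q.
Qed.

(** A common point of the two balls would join their centres by a detour of at most [2 t] edges.
    Splicing it into [p] in place of the stretch from [i] to [j], which has more than [2 t] edges,
    would contradict minimality. *)
Lemma geodesic_balls_disjoint t x p (i j : nat) :
    path G x p ->
    (forall q, path G x q -> last x q = last x p -> (size p <= size q)%N) ->
    (i + (t + t) < j)%N -> (j <= size p)%N ->
  [disjoint ball_of t (last x (take i p)) & ball_of t (last x (take j p))].
Proof.
move=> Gp min_p ltij lejp; apply/pred0P => z; apply/negbTE/negP.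
move=> /andP[/ball_of_meet_path zi /zi[q [Gq qj sq]]].
have := Gp; rewrite -{1}(cat_take_drop i p) cat_path => /andP[Gi _].
have := Gp; rewrite -{1}(cat_take_drop j p) cat_path => /andP[_ Gj].
have : (size p <= size (take i p ++ q ++ drop j p))%N.
  apply: min_p; first by rewrite !cat_path Gi Gq qj Gj.
  by rewrite !last_cat qj -last_cat cat_take_drop.
by rewrite !size_cat size_drop size_takel; lia.
Qed.

Lemma shortest_path_size t x p :
    path G x p ->
    (forall q, path G x q -> last x q = last x p -> (size p <= size q)%N) ->
    (forall y, (#|T| < 4 * #|ball_of t y|)%N) ->
  (size p < 3 * (t + t).+1)%N.
Proof.
move=> Gp min_p bigB; rewrite ltnNge; apply/negP => lp.
(* [2 t + 1] is the least spacing that makes the balls disjoint, and the last centre, at position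
   [3 (2 t + 1)], still lies on [p] by [lp]. *)
pose F (i : 'I_4) := ball_of t (last x (take (i * (t + t).+1) p)).
have ltF (i j : 'I_4) : (i < j)%N -> [disjoint F i & F j].
  move=> ltij; apply: geodesic_balls_disjoint => //.
  - have := leq_mul ltij (leqnn (t + t).+1); lia.
  - have := leq_mul (ltn_ord j : (j <= 3)%N) (leqnn (t + t).+1); lia.
have disjF (i j : 'I_4) : i != j -> [disjoint F i & F j].
  rewrite -val_eqE neq_ltn => /orP[/ltF //|/ltF].
  by rewrite disjoint_sym.
have card_bigcup : #|(\bigcup_i F i)%SET| = (\sum_i #|F i|)%N.
  rewrite -sum1_card (partition_disjoint_bigcup addn) //.
  by apply: eq_bigr => i _; rewrite sum1_card.
have : (4 * #|T| < 4 * \sum_(i < 4) #|F i|)%N.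
  rewrite !big_ord_recr big_ord0 /=.
  have := bigB (last x (take (0 * (t + t).+1) p)).
  have := bigB (last x (take (1 * (t + t).+1) p)).
  have := bigB (last x (take (2 * (t + t).+1) p)).
  have := bigB (last x (take (3 * (t + t).+1) p)).
  rewrite /F /=; lia.
have := max_card (\bigcup_i F i)%SET.
by rewrite card_bigcup ltn_pmul2l // leqNgt => /negP.
Qed.

(** The first alternative persists, since balls only grow. Under the second one, a ball with at most
    [k] points expands by [phi]; a larger one is out of reach of the expansion hypothesis, which is
    then applied to [k] of its points. *)
Lemma card_ball_of_expand (R : realType) (phi : R) (k t : nat) x :
    0 <= phi -> (0 < k)%N ->
    (forall S, (0 < #|S| <= k)%N -> phi * #|S|%:R <= #|boundary G S|%:R) ->
  (1 + phi) * k%:R <= #|ball_of t x|%:R \/ phi ^+ t <= #|ball_of t x|%:R.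
Proof.
move=> phi0 k0 expG; elim: t => [|t [IH|IH]].
- by right; rewrite cards1 expr0.
- by left; apply: (le_trans IH); rewrite ler_nat card_ball_ofS.
have [lek|/ltnW/card_geqP[s [us sk sB]]] := leqP #|ball_of t x| k.
- right; rewrite exprS (le_trans (ler_wpM2l phi0 IH)) //.
  apply: le_trans (expG _ _) _; first by rewrite card_ball_of_gt0 lek.
  by rewrite ler_nat /= card_cl_neighbors leq_addl.
- left; pose S := [set y in s]%SET.
  have cS : #|S| = k by rewrite cardsE (card_uniqP us) sk.
  have sSB : S \subset ball_of t x.
    by apply/fintype.subsetP => y; rewrite inE; apply: sB.
  have := subset_leq_card (cl_neighborsS sSB).
  rewrite -(ler_nat R); apply: le_trans.
  rewrite card_cl_neighbors natrD mulrDl mul1r cS lerD2l.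
  by have := expG S; rewrite cS k0 leqnn; apply.
Qed.

Lemma big_balls_connected t :
  (forall x, (#|T| < 2 * #|ball_of t x|)%N) -> connected_graph G.
Proof.
move=> bigB u v.
have [/disjoint_setI0 dis|] := boolP [disjoint ball_of t u & ball_of t v].
  have := max_card (mem (ball_of t u :|: ball_of t v)%SET).
  by rewrite cardsU dis cards0; move: (bigB u) (bigB v); lia.
case/pred0Pn => z /andP[zu zv].
have [p [Gp <- _]] := ball_of_meet_path zu zv.
by apply/connectP; exists p.
Qed.

End Balls.

(** Rounding [alpha * n] down loses less than 1, hence less than [1 / n] after division, and the
    slack in the hypothesis pays for this. *)
Lemma truncn_mul_gt (R : realType) (phi alpha : R) (n : nat) :
    0 < alpha -> 1 / (2 + 2 * phi) + n%:R^-1 <= alpha -> (0 < n)%N ->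
  1 / (2 + 2 * phi) < (Num.truncn (alpha * n%:R))%:R / n%:R.
Proof.
move=> alpha0 le_alpha n0; have n0R : 0 < n%:R :> R by rewrite ltr0n.
rewrite ltr_pdivlMr //.
have := truncnS_gt (alpha * n%:R); rewrite -natr1.
have := ler_wpM2r (ltW n0R) le_alpha.
rewrite mulrDl mulVf ?gt_eqF //; lra.
Qed.

Lemma diameter_le (R : realType) (T : finType) (G : sgraph T) (d : nat) :
    (forall u v, exists p, [/\ path G u p, last u p = v & (size p <= d)%N]) ->
  (diameter R G <= d%:R%:E)%E.
Proof.
move=> short; apply: ge_ereal_sup => _ [[u v] _ <-] /=.
have [p [Gp pv sp]] := short u v.
apply: (@le_trans _ _ (size p)%:R%:E); last by rewrite lee_fin ler_nat.
by apply: ereal_inf_lbound; exists p.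
Qed.

Lemma ltr_expn_logb (R : realType) (b x : R) :
  1 < b -> 0 < x -> x < b ^+ (Num.truncn (logb b x)).+1.
Proof.
move=> b1 x0; have b0 : 0 < b by apply: lt_trans b1.
rewrite -ltr_ln ?posrE ?exprn_gt0 // lnXn // -mulr_natl.
by rewrite -ltr_pdivrMr ?ln_gt0 // truncnS_gt.
Qed.

Lemma logb_ge1 (R : realType) (b x : R) : 1 < b -> b <= x -> 1 <= logb b x.
Proof.
move=> b1 bx; have b0 : 0 < b by apply: lt_trans b1.
rewrite /logb ler_pdivlMr ?ln_gt0 // mul1r ler_ln ?posrE //.
exact: lt_le_trans bx.
Qed.

Lemma expander_diameter (R : realType) (phi alpha : R) (T : finType)
    (G : sgraph T) :
    1 < phi -> 1 / (2 + 2 * phi) < alpha -> expander phi alpha G ->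
    1 / (2 + 2 * phi) < (Num.truncn (alpha * #|T|%:R))%:R / #|T|%:R \/
      (connected_graph G /\ 1 <= alpha * #|T|%:R) ->
  (diameter R G <= (16 * logb phi #|T|%:R)%:E)%E.
Proof.
move=> phi1 halpha [/andP[phi0 phin] /andP[alpha0 _] expG] hcase.
set n := #|T| in phin expG hcase *; set k := Num.truncn _ in hcase.
have n0 : 0 < n%:R :> R by apply: lt_trans phin.
have den0 : 0 < 2 + 2 * phi by lra.
have L1 : 1 <= logb phi n%:R by rewrite logb_ge1 // ltW.
set L := logb phi _ in L1 *; pose r := (Num.truncn L).+1.
have an0 : 0 <= alpha * n%:R by rewrite mulr_ge0 // ltW.
(* In the first case of [hcase], [k = 0] would put a positive number below 0. *)
have k0 : (0 < k)%N.
  case: hcase => [|[_]]; last by rewrite truncn_gt0.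
  case: (k) => //; rewrite mul0r.
  by move/(lt_trans (divr_gt0 ltr01 den0)); rewrite ltxx.
have expk (S : {set T}) : (0 < #|S| <= k)%N ->
    phi * #|S|%:R <= #|boundary G S|%:R.
  move=> /andP[S0 Sk]; apply: expG => //.
  by apply: (@le_trans _ _ k%:R); rewrite ?ler_nat // truncn_le.
(* After [r] steps [phi ^+ r] exceeds [n], so the geometric alternative is impossible. *)
have bigB x : (1 + phi) * k%:R <= #|ball_of G r x|%:R.
  have [//|big] := @card_ball_of_expand _ G R phi k r x (ltW phi0) k0 expk.
  have := lt_le_trans (ltr_expn_logb phi1 n0) big.
  by rewrite ltr_nat ltnNge max_card.
(* [n < (2 + 2 phi) alpha n < (2 + 2 phi) (k + 1) <= 4 (1 + phi) k]. *)
have ball4 x : (n < 4 * #|ball_of G r x|)%N.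
  rewrite -(ltr_nat R) natrM.
  have : alpha * n%:R < k%:R + 1 by rewrite natr1 truncnS_gt.
  have : n%:R < (2 + 2 * phi) * (alpha * n%:R).
    by rewrite mulrA ltr_pMl // mulrC -ltr_pdivrMr.
  have : 1 <= k%:R :> R by rewrite ler1n.
  have := bigB x; nra.
(* When [k / n] itself passes the threshold, [n < 2 (1 + phi) k], so each ball holds more than half
   of the vertices. *)
have Gconn : connected_graph G.
  case: hcase => [|[]//] hk; apply: (@big_balls_connected _ _ r) => x.
  rewrite -(ltr_nat R) natrM.
  have : n%:R < (2 + 2 * phi) * k%:R.
    by move: hk; rewrite ltr_pdivlMr // mulrAC ltr_pdivrMr // mul1r mulrC.
  have := bigB x; lra.
(* A shortest path has at most [6 r + 2] edges, which is at most [8 r] because [r >= 1]. *)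
apply: (@le_trans _ _ (8 * r)%:R%:E).
  apply: diameter_le => u v.
  have [p [Gp pv min_p]] := shortest_path (Gconn u v).
  exists p; split=> //; rewrite -pv in min_p.
  have := shortest_path_size Gp min_p ball4; rewrite /r; lia.
(* [8 r <= 8 (L + 1) <= 16 L], where [L >= 1] comes from [phi < n]. *)
rewrite lee_fin natrM /r -natr1.
have : (Num.truncn L)%:R <= L by rewrite truncn_le (le_trans ler01).
lra.
Qed.

Theorem lemma4p4 (R : realType) :
  exists C : R,
    (forall (phi alpha : R) (T : finType) (G : sgraph T),
       1 < phi -> 1 / (2 + 2 * phi) < alpha -> expander phi alpha G ->
       1 / (2 + 2 * phi) < (Num.truncn (alpha * #|T|%:R))%:R / #|T|%:R \/
         (connected_graph G /\ 1 <= alpha * #|T|%:R) ->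
       (diameter R G <= (C * logb phi #|T|%:R)%:E)%E)
    /\
    (forall phi alpha : R,
       1 < phi -> 1 / (2 + 2 * phi) < alpha ->
       exists N : nat, forall (T : finType) (G : sgraph T),
         (N <= #|T|)%N -> expander phi alpha G ->
         (diameter R G <= (C * logb phi #|T|%:R)%:E)%E).
Proof.
exists 16; split=> [|phi alpha phi1 halpha]; first exact: expander_diameter.
pose d := alpha - 1 / (2 + 2 * phi).
have d0 : 0 < d by rewrite subr_gt0.
(* This threshold exceeds [1 / d], so [1 / n <= d] and the gap between [alpha] and [1 / (2 + 2 phi)]
   absorbs the rounding. *)
exists (Num.truncn d^-1).+1 => T G leN expG.
apply: (expander_diameter phi1 halpha expG); left.
have [_ /andP[alpha0 _] _] := expG.
have T0 : (0 < #|T|)%N by apply: leq_trans leN.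
apply: truncn_mul_gt => //; rewrite addrC -lerBrDr -/d invf_ple ?posrE ?ltr0n //.
by apply: ltW; apply: lt_le_trans (truncnS_gt _) _; rewrite ler_nat.
Qed.
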